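(* Let $t\ge 3$ be an integer and let $G$ be a $C_t$-free bipartite graph of order $n$. (i) If $t$ is odd or $n<t$, then $\rho(G)\leq \sqrt{\lfloor\frac n2\rfloor\lceil\frac n2\rceil}$, with equality if and only if $G\cong K_{\lfloor\frac n2\rfloor, \lceil\frac n2\rceil}$. (ii) If $t=2k+2$ for an integer $k\ge1$ and $n\geq t$, then $\rho(G)\leq \sqrt{k(n-k)}$, with equality if and only if $G\cong K_{k,n-k}$.
   Context: All graphs are finite and simple. $\rho(G)$ denotes the spectral radius (largest modulus of an eigenvalue) of the adjacency matrix of $G$. $C_t$ denotes the cycle on $t$ vertices. A graph is $H$-free if it contains no subgraph isomorphic to $H$. $K_{a,b}$ is the complete bipartite graph with parts of sizes $a$ and $b$. *)

(* Defs.v *)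
From HB Require Import structures.
From mathcomp Require Import all_boot all_order all_algebra.
From mathcomp Require Import all_classical reals.
From mathcomp Require Export complex.

Set Implicit Arguments.
Unset Strict Implicit.
Unset Printing Implicit Defensive.

Import Order.TTheory GRing.Theory Num.Theory.
Local Open Scope ring_scope.

Record sgraph := SGraph {
  vertex :> finType;
  edge : rel vertex;
  edge_sym : symmetric edge;
  edge_irrefl : irreflexive edge }.

Definition isomorphic (G H : sgraph) : Prop :=
  exists f : G -> H, bijective f /\ forall x y, edge (f x) (f y) = edge x y.

(* An injective edge-preserving map is the same as an isomorphism of H onto a
   (not necessarily induced) subgraph of G. *)
Definition contains (G H : sgraph) : Prop :=
  exists f : H -> G, injective f /\ forall x y, edge x y -> edge (f x) (f y).

Definition subgraph_free (H G : sgraph) : Prop := ~ contains G H.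

(* One of the two parts A, ~: A may be empty. *)
Definition bipartite (G : sgraph) : Prop :=
  exists A : {set G}, forall x y : G, edge x y -> (x \in A) != (y \in A).

(* The test i != j only matters for t = 1, where i.+1 %% t = i. *)
Definition cycle_edge (t : nat) : rel 'I_t :=
  fun i j => (i != j) && ((i.+1 %% t == j)%N || (j.+1 %% t == i)%N).

Lemma cycle_edge_sym t : symmetric (@cycle_edge t).
Proof. by move=> i j; rewrite /cycle_edge eq_sym orbC. Qed.

Lemma cycle_edge_irrefl t : irreflexive (@cycle_edge t).
Proof. by move=> i; rewrite /cycle_edge eqxx. Qed.

Definition cycle_graph (t : nat) : sgraph :=
  SGraph (@cycle_edge_sym t) (@cycle_edge_irrefl t).

Definition biclique_edge (a b : nat) : rel ('I_a + 'I_b)%type :=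
  fun u v => match u, v with
             | inl _, inr _ | inr _, inl _ => true
             | _, _ => false
             end.

Lemma biclique_edge_sym a b : symmetric (@biclique_edge a b).
Proof. by case=> i [] j. Qed.

Lemma biclique_edge_irrefl a b : irreflexive (@biclique_edge a b).
Proof. by case. Qed.

Definition complete_bipartite (a b : nat) : sgraph :=
  SGraph (@biclique_edge_sym a b) (@biclique_edge_irrefl a b).

Definition adjacency (K : nzRingType) (G : sgraph) : 'M[K]_#|G| :=
  \matrix_(i, j) (edge (enum_val i) (enum_val j))%:R.

(* The supremum is a maximum as soon as G has a vertex, see
   spectral_radius_max; the graph without vertices gets the value sup set0 = 0. *)
Definition spectral_radius (R : realType) (G : sgraph) : R :=
  sup [set r : R | exists2 l : R[i],
         eigenvalue (adjacency R[i] G) l & r = Normc.normc l].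

Lemma spectral_radius_max (R : realType) (G : sgraph) : (0 < #|G|)%N ->
  (exists2 l : R[i], eigenvalue (adjacency R[i] G) l &
      Normc.normc l = spectral_radius R G) /\
  (forall l : R[i], eigenvalue (adjacency R[i] G) l ->
      Normc.normc l <= spectral_radius R G).
Proof.
move=> G0; rewrite /spectral_radius; set A := adjacency _ _.
have [s sE] := closed_field_poly_normal (char_poly A).
rewrite (eqP (char_poly_monic A)) scale1r in sE.
have eigE l : eigenvalue A l = (l \in s).
  by rewrite eigenvalue_root_char sE root_prod_XsubC.
have s0 : (0 < size s)%N.
  have := size_char_poly A; rewrite sE size_prod_XsubC => -[] ->; exact: G0.
pose f (i : 'I_(size s)) : R := Normc.normc s`_i.
have [i _ imax] := @arg_maxP _ _ _ (Ordinal s0) xpredT f isT.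
have ub l : l \in s -> Normc.normc l <= f i.
  move=> ls; have lt := ls; rewrite -index_mem in lt.
  by have := imax (Ordinal lt) isT; rewrite /f /= nth_index.
have si : eigenvalue A s`_i by rewrite eigE mem_nth.
set E : set R := (X in sup X).
have Eub : ubound E (f i) by move=> _ [l le ->]; apply: ub; rewrite -eigE.
have Ei : E (f i) by exists s`_i.
have -> : sup E = f i.
  apply/eqP; rewrite eq_le; apply/andP; split.
    by apply: ge_sup => //; exists (f i).
  by apply: ub_le_sup => //; exists (f i).
by split; [exists s`_i | move=> l; rewrite eigE; exact: ub].
Qed.

(* Main.v *)
Require Import Defs.
From mathcomp Require Import all_boot all_order all_algebra.
From mathcomp Require Import reals zify.

(* The row sum of A^2 at a vertex u, A being the adjacency matrix, is the number
   of walks of length two from u, so rho^2 is at most the largest such number.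
   If G has no C_(2k+2), the bipartite graph between N = N(u) and B = the other
   vertices distinct from u has no alternating path with k+1 vertices in N and k
   in B; this forces e(N,B) + k(k-1) <= (k-1)|N| + k|B|, whence at most k(n-k)
   walks, with strict inequality if some vertex is at distance more than two
   from u.  If equality holds for rho, an eigenvector of maximal modulus at u has
   maximal modulus at every vertex reached from u by a walk of length two, and
   each such vertex attains the bound; so G is complete bipartite, and the
   product of the sizes of its parts determines them. *)

Set Implicit Arguments.
Unset Strict Implicit.
Unset Printing Implicit Defensive.

Import Order.TTheory GRing.Theory Num.Theory.
Local Open Scope ring_scope.

(** * Cycles as closed paths *)

(** Index [i] goes to entry [i] of the list; the wrap-around from [size s] to 0 is the closing edge
    of [cycle]. *)
Lemma contains_cycle (G : sgraph) (u : G) (s : seq G) :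
  cycle (@edge G) (u :: s) -> uniq (u :: s) ->
  contains G (cycle_graph (size s).+1).
Proof.
move=> cs us; exists (fun i : 'I_(size s).+1 => nth u (u :: s) i); split.
  by move=> i j /eqP; rewrite nth_uniq // => /eqP/val_inj.
have step (i j : 'I_(size s).+1) : (i.+1 %% (size s).+1 == j)%N ->
    edge (nth u (u :: s) i) (nth u (u :: s) j).
  move: cs; rewrite /cycle rcons_path => /andP[ps pl] /eqP <-.
  have := ltn_ord i; rewrite ltnS leq_eqVlt => /predU1P[->|lis].
    by rewrite modnn /= nth_last.
  by rewrite modn_small // /=; apply/(pathP u).
move=> i j /andP[_ /orP[ij|ji]]; first exact: step.
by rewrite edge_sym; exact: step.
Qed.

(** * Edge counts in the absence of long alternating paths *)

Definition edges_between {T : finType} (e : rel T) (A B : {set T}) : nat :=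
  (\sum_(x in A) \sum_(y in B) e x y)%N.

Section EdgesBetween.
Variables (T : finType) (e : rel T).
Hypothesis e_sym : symmetric e.
Local Open Scope nat_scope.

Lemma edges_betweenC (A B : {set T}) : edges_between e A B = edges_between e B A.
Proof.
rewrite /edges_between exchange_big /=; apply: eq_bigr => y _.
by apply: eq_bigr => x _; rewrite e_sym.
Qed.

Lemma edges_betweenD1 (A B : {set T}) x : x \in A ->
  edges_between e A B = \sum_(y in B) e x y + edges_between e (A :\ x) B.
Proof.
move=> xA; rewrite /edges_between (bigD1 x) //=; congr (_ + _).
by apply: eq_bigl => z; rewrite !inE andbC.
Qed.

Lemma edges_between_le (A B : {set T}) : edges_between e A B <= #|A| * #|B|.
Proof.
rewrite -sum_nat_const; apply: leq_sum => x _.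
by rewrite -sum1_card; apply: leq_sum => y _; case: e.
Qed.

Lemma exists_neighbor_notin (B : {set T}) (s : seq T) x :
  count (mem B) s < \sum_(y in B) e x y -> exists2 y, y \in B & e x y && (y \notin s).
Proof.
move=> h; apply/exists_inP; apply: contraLR h => /exists_inPn h.
rewrite -leqNgt -big_mkcondr /= sum1_card -size_filter.
apply: leq_trans (card_size _); apply/subset_leq_card/subsetP => y.
rewrite unfold_in => /andP[yB exy]; rewrite mem_filter /= yB.
by move: (h y yB); rewrite exy /= negbK.
Qed.

(* The path x :: s has 2k edges.  Alternation between A and B is not required: it
   is automatic when neither part contains an edge. *)
Definition alternating_path_free k (A B : {set T}) : Prop := forall x s,
  x \in A -> last x s \in A -> path e x s -> uniq (x :: s) ->
  {subset s <= A :|: B} -> size s != k.*2.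

Lemma alternating_path_freeS k (A B A' B' : {set T}) :
  A' \subset A -> B' \subset B ->
  alternating_path_free k A B -> alternating_path_free k A' B'.
Proof.
move=> sA sB free x s xA lA p us sub; apply: (free x) => //; try exact: (subsetP sA).
by move=> y /sub; apply/subsetP/setUSS.
Qed.

(** Greedy growth at the head, by a vertex of [B] and then one of [A]: after [i < k] rounds the path
    holds [i] vertices of [B] and [i.+1] of [A], so the degrees always leave fresh neighbours. After
    [k] rounds it is a forbidden path. *)
Lemma alternating_path_min_degree k (A B : {set T}) : [disjoint A & B] ->
  (exists x, x \in A) ->
  {in A, forall x, k <= \sum_(y in B) e x y} ->
  {in B, forall y, k < \sum_(x in A) e y x} ->
  ~ alternating_path_free k A B.
Proof.
move=> dAB [x0 x0A] degA degB free.
(* The counts concern the tail [s] only; the head [x] is one more vertex of [A]. *)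
have path_of_length i : i <= k -> exists x s, [/\ x \in A, last x s \in A,
    path e x s, uniq (x :: s) & {subset s <= A :|: B}] /\
    count (mem A) s = i /\ count (mem B) s = i.
  elim: i => [|i IHi] ik; first by exists x0, [::].
  have [x [s [[xA lA p us sub] [cA cB]]]] := IHi (ltnW ik).
  have [y yB /andP[exy ys]] : exists2 y, y \in B & e x y && (y \notin s).
    by apply: exists_neighbor_notin; rewrite cB (leq_trans ik) ?degA.
  have yA : y \notin A by rewrite (disjointFl dAB).
  have [z zA /andP[eyz zs]] : exists2 z, z \in A & e y z && (z \notin x :: s).
    apply: exists_neighbor_notin; rewrite /= xA cA add1n.
    by rewrite (leq_ltn_trans ik) ?degB.
  have zB : z \notin B by rewrite (disjointFr dAB).
  exists z, [:: y, x & s]; split; first split=> //.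
  - by rewrite /= e_sym eyz e_sym exy.
  - rewrite cons_uniq inE negb_or zs (contraNneq _ yA) => [|<- //].
    by rewrite cons_uniq inE negb_or ys us (contraNneq _ yA) // => ->.
  - move=> w; rewrite !inE => /or3P[/eqP->|/eqP->|/sub]; rewrite ?inE //.
      by rewrite yB orbT.
    by rewrite xA.
  - by rewrite /= xA yB (negPf yA) (disjointFr dAB xA) cA cB.
have [x [s [[xA lA p us sub] [cA cB]]]] := path_of_length k (leqnn k).
case/eqP: (free x s xA lA p us sub).
rewrite -(count_predC (mem A)) cA -addnn; congr (_ + _).
rewrite -[RHS]cB; apply: eq_in_count => y /sub; rewrite !inE.
by case: (boolP (y \in A)) => //= yA _; rewrite (disjointFr dAB yA).
Qed.

(* Deleting a vertex of small degree (at most k in A, at most k+1 in B) preserves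
   the claim, and one exists by [alternating_path_min_degree]; the recursion
   stops at 2k+1 vertices, where e(A,B) <= |A| |B| is already enough. *)
Lemma edges_between_alternating_path_free k (A B : {set T}) :
  [disjoint A & B] -> alternating_path_free k.+1 A B ->
  k.*2.+1 <= #|A| + #|B| ->
  edges_between e A B + k * k.+1 <= k * #|A| + k.+1 * #|B|.
Proof.
move: {2}(#|A| + #|B|) (erefl (#|A| + #|B|)) => m.
elim: m A B => [|m IHm] A B; first by move=> ->.
move=> cAB dAB free; rewrite leq_eqVlt => /predU1P[eqk|ltk].
  apply: leq_trans (leq_add (edges_between_le A B) (leqnn _)) _.
  (* The claim amounts to (a - (k+1))(b - k) <= 0, and a + b = 2k+1 makes the two factors
     opposite. *)
  move: #|A| #|B| eqk => a b eqk.
  have [ak|/ltnW ak] := leqP a k.+1.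
    have -> : b = k + (k.+1 - a) by lia.
    by move: (k.+1 - a) (subnKC ak) => d <-; nia.
  have kE : k = b + (a - k.+1) by lia.
  have -> : a = (k + (a - k.+1)).+1 by lia.
  by move: (a - k.+1) kE => d ->; nia.
have [/exists_inP[x xA dx]|/exists_inPn hA] :=
  boolP [exists x in A, \sum_(y in B) e x y <= k].
  have cA : #|A| = #|A :\ x|.+1 by rewrite (cardsD1 x) xA.
  have sA : A :\ x \subset A by apply: subsetDl.
  have mA : #|A :\ x| + #|B| = m by lia.
  have dAB' : [disjoint A :\ x & B] by apply: disjointWl dAB.
  have free' := alternating_path_freeS sA (subxx B) free.
  by have := IHm _ _ mA dAB' free'; rewrite (edges_betweenD1 _ xA); lia.
have [/exists_inP[x xB dx]|/exists_inPn hB] :=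
  boolP [exists y in B, \sum_(x in A) e y x <= k.+1].
  have cB : #|B| = #|B :\ x|.+1 by rewrite (cardsD1 x) xB.
  have sB : B :\ x \subset B by apply: subsetDl.
  have mB : #|A| + #|B :\ x| = m by lia.
  have dAB' : [disjoint A & B :\ x] by apply: disjointWr dAB.
  have free' := alternating_path_freeS (subxx A) sB free.
  have := IHm _ _ mB dAB' free'.
  rewrite [edges_between e A B]edges_betweenC (edges_betweenD1 _ xB).
  by rewrite edges_betweenC; lia.
have degB : {in B, forall y, k.+1 < \sum_(x in A) e y x}.
  by move=> y /hB; rewrite ltnNge.
case: (@alternating_path_min_degree k.+1 A B) => //; last first.
  by move=> x /hA; rewrite ltnNge.
(* If [A] were empty, [B] would not be, and its vertices would have neighbours in an empty set. *)
apply/set0Pn/eqP => A0; move: cAB ltk; rewrite A0 cards0 add0n => cB _.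
have /card_gt0P[y /degB] : 0 < #|B| by rewrite cB.
by rewrite A0 big_set0.
Qed.

End EdgesBetween.

(** * Moduli of eigenvectors and walks of length two *)

Lemma normc_sum (R : rcfType) (I : finType) (F : I -> R[i]) :
  Normc.normc (\sum_i F i) <= \sum_i Normc.normc (F i).
Proof.
elim/big_ind2: _ => [|x a y b xa yb|//]; first by rewrite Normc.normc0.
exact: le_trans (le_normcD _ _) (lerD xa yb).
Qed.

Lemma normc_nat (R : rcfType) (n : nat) : Normc.normc (n%:R : R[i]) = n%:R.
Proof. by rewrite (normcMn (1 : R[i])) Normc.normc1. Qed.

Lemma normc_ge0 (R : rcfType) (x : R[i]) : 0 <= Normc.normc x.
Proof. by case: x => a b; apply: sqrtr_ge0. Qed.

(** Eigenvectors become functions on vertices instead of row vectors indexed by ordinals; symmetry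
    of [edge] lets the matrix act from either side. *)
Lemma eigenvalue_adjacencyP (K : fieldType) (G : sgraph) (l : K) :
  reflect (exists2 x : G -> K, (exists g, x g != 0) &
             forall g, \sum_h (edge g h)%:R * x h = l * x g)
          (eigenvalue (adjacency K G) l).
Proof.
apply: (iffP eigenvalueP) => [[v vA v0]|[x [g xg] xE]].
  exists (fun g => v 0 (enum_rank g)).
    have [i vi] := rV0Pn _ v0.
    by exists (enum_val i); rewrite enum_valK.
  move=> g; have /rowP/(_ (enum_rank g)) := vA; rewrite !mxE => <-.
  rewrite (reindex (@enum_val G G)) /=; last exact/onW_bij/enum_val_bij.
  by apply: eq_bigr => i _; rewrite !mxE enum_valK enum_rankK edge_sym mulrC.
exists (\row_i x (enum_val i)).
  apply/rowP => i; rewrite !mxE -xE.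
  rewrite [RHS](reindex (@enum_val G G)) /=; last exact/onW_bij/enum_val_bij.
  by apply: eq_bigr => j _; rewrite !mxE mulrC edge_sym.
by apply/rV0Pn; exists (enum_rank g); rewrite mxE enum_rankK.
Qed.

(** An entry of the square of the adjacency matrix. *)
Definition walks2 {G : sgraph} (u w : G) : nat :=
  (\sum_v edge u v * edge v w)%N.

Definition total_walks2 {G : sgraph} (u : G) : nat := (\sum_w walks2 u w)%N.

(* M is the set of vertices at which an eigenvector has maximal modulus. *)
Lemma max_modulus_eigenvector (R : rcfType) (G : sgraph) (l : R[i]) (N : nat) :
  eigenvalue (adjacency R[i] G) l ->
  (forall u : G, total_walks2 u <= N)%N ->
  Normc.normc l ^+ 2 <= N%:R /\
  (Normc.normc l ^+ 2 = N%:R -> exists2 M : {set G}, (exists u, u \in M) &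
     forall u, u \in M -> total_walks2 u = N /\
       forall w, (0 < walks2 u w)%N -> w \in M).
Proof.
move=> /eigenvalue_adjacencyP[x [g xg] xE] leN.
pose f u := Normc.normc (x u).
have [u0 _ max0] := @arg_maxP _ _ _ g xpredT f isT.
have u0max u : f u <= f u0 by exact: max0.
have f0 : 0 < f u0.
  apply: lt_le_trans (u0max g); rewrite lt_def normc_ge0 andbT.
  by apply: contra xg => /eqP/Normc.eq0_normc ->.
have A2 (u : G) : \sum_w (walks2 u w)%:R * x w = l ^+ 2 * x u.
  rewrite expr2 -mulrA -xE big_distrr /=.
  under [RHS]eq_bigr => v _ do rewrite mulrCA -xE big_distrr /=.
  rewrite exchange_big /=; apply: eq_bigr => w _.
  rewrite natr_sum big_distrl /=; apply: eq_bigr => v _.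
  by rewrite natrM mulrA.
have le1 (u : G) : Normc.normc l ^+ 2 * f u <= \sum_w (walks2 u w)%:R * f w.
  have -> : Normc.normc l ^+ 2 * f u = Normc.normc (\sum_w (walks2 u w)%:R * x w).
    by rewrite A2 !Normc.normcM.
  apply: (le_trans (normc_sum _)).
  rewrite le_eqVlt; apply/orP; left; apply/eqP.
  by apply: eq_bigr => w _; rewrite Normc.normcM normc_nat.
have le2 (u : G) : \sum_w (walks2 u w)%:R * f w <= (total_walks2 u)%:R * f u0.
  rewrite natr_sum big_distrl /=; apply: ler_sum => w _.
  by rewrite ler_wpM2l ?ler0n ?u0max.
have le3 (u : G) : (total_walks2 u)%:R * f u0 <= N%:R * f u0.
  by rewrite ler_pM2r ?ler_nat ?leN.
split.
  by rewrite -(ler_pM2r f0); apply: le_trans (le1 u0) (le_trans (le2 u0) (le3 u0)).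
move=> lN; exists [set u | f u == f u0]; first by exists u0; rewrite inE.
move=> u; rewrite inE => /eqP fu.
(* At such a [u] the chain [le1], [le2], [le3] starts and ends at the same number, so every link is
   an equality. *)
have eqs : \sum_w (walks2 u w)%:R * f w = N%:R * f u0.
  apply/eqP; rewrite eq_le (le_trans (le2 u) (le3 u)) /=.
  by have := le1 u; rewrite lN fu.
have totE : total_walks2 u = N.
  apply/eqP; rewrite -(eqr_nat R) -(inj_eq (mulIf (lt0r_neq0 f0))) eq_le le3 -eqs.
  exact: le2.
split=> // w uw; rewrite inE eq_le u0max //=.
(* All terms are nonnegative, so each vanishes, and a positive walk count forces [f w = f u0]. *)
have : \sum_v (walks2 u v)%:R * (f u0 - f v) = 0.
  under eq_bigr => v _ do rewrite mulrBr.
  by rewrite sumrB eqs -totE natr_sum big_distrl /= subrr.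
move/eqP; rewrite psumr_eq0 => [/allP/(_ w (mem_index_enum w))|v _].
  rewrite implyTb mulf_eq0 pnatr_eq0 -leqn0 leqNgt uw /= subr_eq0 => /eqP ->.
  exact: lexx.
by rewrite mulr_ge0 // subr_ge0 u0max.
Qed.

Definition neighborhood (G : sgraph) (u : G) : {set G} := [set v | edge u v].

Lemma walks2_gt0 (G : sgraph) (u v w : G) :
  edge u v -> edge v w -> (0 < walks2 u w)%N.
Proof. by move=> uv vw; rewrite /walks2 (bigD1 v) //= uv vw. Qed.

Lemma total_walks2E (G : sgraph) (u : G) :
  total_walks2 u = edges_between (@edge G) (neighborhood u) setT.
Proof.
rewrite /total_walks2 /walks2 exchange_big /edges_between [RHS]big_mkcond /=.
apply: eq_bigr => v _; rewrite inE -big_distrr /=.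
case: ifP => _; rewrite ?mul0n // mul1n.
by apply: eq_bigl => w; rewrite inE.
Qed.

(** * Complete bipartite graphs and the case of equality *)

Lemma isomorphic_complete_bipartite (G : sgraph) (A : {set G}) :
  (forall x y : G, edge x y = ((x \in A) != (y \in A))) ->
  isomorphic G (complete_bipartite #|A| #|~: A|).
Proof.
move=> eA.
pose g (z : 'I_#|A| + 'I_#|~: A|) : G :=
  match z with inl i => enum_val i | inr j => enum_val j end.
have gA z : (g z \in A) = if z is inl _ then true else false.
  case: z => i /=; first exact: enum_valP.
  by have := enum_valP i; rewrite inE => /negPf.
have g_inj : injective g.
  move=> z z' gzz'; have := gA z; rewrite gzz' gA.
  by case: z z' gzz' => i [] j //= /enum_val_inj ->.
have [|f fK gK] := inj_card_bij g_inj.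
  by rewrite card_sum !card_ord cardsC.
exists f; split; first by exists g.
move=> x y; rewrite -{2}(gK x) -{2}(gK y) eA !gA.
by case: (f x) (f y) => i [] j.
Qed.

Lemma spectral_radius_no_vertex (R : realType) (G : sgraph) :
  #|G| = 0%N -> spectral_radius R G = 0.
Proof.
move=> G0; rewrite /spectral_radius -[RHS](@sup0 R); congr sup.
apply/classical_sets.seteqP; split=> // r [l /eigenvalue_adjacencyP[x [g _] _] _].
by have := card0_eq G0 g.
Qed.

(** The vector with value sqrt b on the part of size [a] and sqrt a on the part of size [b] is an
    eigenvector for sqrt (a b). *)
Lemma spectral_radius_complete_bipartite (R : realType) (G : sgraph) a b :
  isomorphic G (complete_bipartite a b) ->
  Num.sqrt (a * b)%:R <= spectral_radius R G.
Proof.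
move=> [f [[g fK gK] fE]].
have [G0|/card_gt0P[v _]] := posnP #|G|.
  rewrite spectral_radius_no_vertex //.
  have : #|complete_bipartite a b| = 0%N by rewrite -(bij_eq_card (Bijective fK gK)).
  rewrite card_sum !card_ord => /eqP; rewrite addn_eq0 => /andP[/eqP-> _].
  by rewrite mul0n sqrtr0.
have Gpos : (0 < #|G|)%N by apply/card_gt0P; exists v.
have [[l0 _ <-] ub] := spectral_radius_max R Gpos.
(* With an empty part the vector below would be zero, but then the bound is 0. *)
have [ab0|ab_gt0] := posnP (a * b)%N.
  by rewrite ab0 sqrtr0 normc_ge0.
move: (ab_gt0); rewrite muln_gt0 => /andP[a_gt0 b_gt0].
have sqrt_neq0 m : (0 < m)%N -> (Num.sqrt m%:R : R)%:C%C != 0.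
  by move=> m0; rewrite fmorph_eq0 gt_eqF ?sqrtr_gt0 ?ltr0n.
have sqrtMl m p : Num.sqrt p%:R *+ m = Num.sqrt (m * p)%:R * Num.sqrt m%:R :> R.
  rewrite natrM sqrtrM ?ler0n // mulrAC -expr2 sqr_sqrtr ?ler0n //.
  by rewrite mulr_natl.
pose x (h : G) : R[i] :=
  match f h with inl _ => Num.sqrt b%:R | inr _ => Num.sqrt a%:R end%:C%C.
have /ub : eigenvalue (adjacency R[i] G) (Num.sqrt (a * b)%:R : R)%:C%C.
  apply/eigenvalue_adjacencyP; exists x.
    by exists v; rewrite /x; case: (f v) => _; apply: sqrt_neq0.
  move=> h; rewrite (reindex g) /=; last by apply/onW_bij; exists f.
  under eq_bigr => z _ do rewrite -fE gK /x gK.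
  rewrite big_sumType /= /x; case: (f h) => i /=.
    rewrite big1 ?add0r => [|z _]; last by rewrite mul0r.
    under eq_bigr => z _ do rewrite mul1r.
    by rewrite sumr_const card_ord -rmorphMn -rmorphM /= sqrtMl mulnC.
  rewrite [X in _ + X]big1 ?addr0 => [|z _]; last by rewrite mul0r.
  under eq_bigr => z _ do rewrite mul1r.
  by rewrite sumr_const card_ord -rmorphMn -rmorphM /= sqrtMl.
by rewrite /Normc.normc /= expr0n addr0 sqrtr_sqr ger0_norm ?sqrtr_ge0.
Qed.

(** By parity, vertices on the side of [u0] are reached by walks of length two and so lie in [M],
    while those on the other side of a vertex of [M] are adjacent to it. Every edge across has an
    end on the side of [u0]. *)
Lemma radius_two_complete (G : sgraph) (A M : {set G}) N :
  (forall x y : G, edge x y -> (x \in A) != (y \in A)) ->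
  (forall u : G, total_walks2 u = N -> forall w, w != u ->
     edge u w \/ exists2 v, edge u v & edge v w) ->
  (exists u, u \in M) ->
  (forall u, u \in M -> total_walks2 u = N /\
       forall w, (0 < walks2 u w)%N -> w \in M) ->
  (forall x y : G, edge x y = ((x \in A) != (y \in A))) /\
  (#|A| * #|~: A| = N)%N.
Proof.
move=> bip rad [u0 u0M] Mp.
have dist1 u w : u \in M -> (u \in A) != (w \in A) -> edge u w.
  move=> uM uw; have [tu _] := Mp u uM.
  have wu : w != u by apply: contraNneq uw => ->.
  have [//|[v /bip uv /bip vw]] := rad u tu w wu.
  by move: uw uv vw; do 3!case: (_ \in A).
have sideM w : (u0 \in A) = (w \in A) -> w \in M.
  move=> uw; have [tu Mu] := Mp u0 u0M.
  have [-> //|wu] := eqVneq w u0.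
  have [/bip|[v uv vw]] := rad u0 tu w wu; first by rewrite uw eqxx.
  exact/Mu/(walks2_gt0 uv vw).
have edgeE x y : edge x y = ((x \in A) != (y \in A)).
  apply/idP/idP => [/bip //|xy].
  have [ux|ux] := eqVneq (u0 \in A) (x \in A); first exact: dist1 (sideM x ux) xy.
  rewrite edge_sym; apply: dist1; last by rewrite eq_sym.
  by apply: sideM; move: ux xy; do 3!case: (_ \in A).
split=> //.
(* From [u0], the first step reaches any vertex of the other side, the second any vertex of its own
   side. *)
have [<- _] := Mp u0 u0M; rewrite total_walks2E /edges_between.
have degE v : (\sum_(w in [set: G]) edge v w = #|if v \in A then ~: A else A|)%N.
  rewrite -sum1_card [RHS]big_mkcond (eq_bigl xpredT) => [|w]; last by rewrite inE.
  by apply: eq_bigr => w _; rewrite edgeE; case: (v \in A);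
    rewrite ?inE; case: (w \in A).
under eq_bigl => v do rewrite inE edgeE.
under eq_bigr => v do rewrite degE.
case: (u0 \in A).
  rewrite (eq_bigr (fun=> #|A|)) => [|v]; last by case: (v \in A); rewrite ?eqxx.
  by rewrite sum_nat_cond_const mulnC; congr (_ * _)%N; apply: eq_card => v.
rewrite (eq_bigr (fun=> #|~: A|)) => [|v]; last by case: (v \in A); rewrite ?eqxx.
rewrite sum_nat_cond_const; congr (_ * _)%N; apply: eq_card => v.
by rewrite !inE; case: (v \in A).
Qed.

(** Reduces both cases of the theorem to counting walks of length two from each vertex. *)
Lemma spectral_radius_extremal (R : realType) (G : sgraph) (A : {set G}) a b :
  (forall x y : G, edge x y -> (x \in A) != (y \in A)) ->
  (a + b)%N = #|G| ->
  (forall u : G, total_walks2 u <= a * b)%N ->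
  (forall u : G, total_walks2 u = (a * b)%N -> forall w, w != u ->
     edge u w \/ exists2 v, edge u v & edge v w) ->
  spectral_radius R G <= Num.sqrt (a * b)%:R /\
  (spectral_radius R G = Num.sqrt (a * b)%:R <->
   isomorphic G (complete_bipartite a b)).
Proof.
move=> bip abG leN rad.
have le_rho : spectral_radius R G <= Num.sqrt (a * b)%:R /\
    (spectral_radius R G = Num.sqrt (a * b)%:R ->
     (forall x y : G, edge x y = ((x \in A) != (y \in A))) /\
     (#|A| * #|~: A| = a * b)%N).
  have [G0|Gpos] := posnP #|G|.
    have noG (x : G) : False by have := card0_eq G0 x.
    rewrite spectral_radius_no_vertex // sqrtr_ge0; split=> // _.
    split=> [x|]; first by have := noG x.
    have card0 (B : {set G}) : #|B| = 0%N by apply: eq_card0 => x; have := noG x.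
    by rewrite !card0; move: abG; rewrite G0; case: a {leN rad}.
  have [[l eigl <-] _] := spectral_radius_max R Gpos.
  have [le_l eq_l] := max_modulus_eigenvector eigl leN.
  split.
    by rewrite -[leLHS](@ger0_norm R) ?normc_ge0 // -sqrtr_sqr ler_sqrt ?ler0n.
  move=> lE; have [|M M0 Mp] := eq_l; first by rewrite lE sqr_sqrtr ?ler0n.
  exact: radius_two_complete bip rad M0 Mp.
split; first by case: le_rho.
split=> [/le_rho.2[edgeE cardE]|/(spectral_radius_complete_bipartite R) ge_rho]; last first.
  by apply/eqP; rewrite eq_le ge_rho le_rho.1.
have := cardsC A; rewrite -abG => cardD.
(* Both pairs have the same sum and the same product, so they agree up to order. *)
have [cA|cA] : #|A| = a \/ #|A| = b.
  by move: cardE cardD; nia.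
- have -> : b = #|~: A| by lia.
  by rewrite -cA; apply: isomorphic_complete_bipartite.
- have -> : a = #|~: A| by lia.
  rewrite -cA -{2}(setCK A); apply: isomorphic_complete_bipartite => x y.
  by rewrite edgeE !inE; do 2!case: (_ \in A).
Qed.

(** * Walks of length two in bipartite graphs *)

Lemma no_edge_between (T : finType) (e : rel T) (x : T) (B : {set T}) :
  (forall y, y \in B -> ~~ e x y) -> (\sum_(y in B) e x y = 0)%N.
Proof. by move=> noe; apply: big1 => y /noe/negPf->. Qed.

(** In the second alternative, deleting [w] from a set keeps its edge count with [neighborhood u];
    this makes the walk bounds strict. *)
Lemma common_neighborP (G : sgraph) (u w : G) :
  (exists2 v, edge u v & edge v w) \/
  {in neighborhood u, forall v, ~~ edge w v}.
Proof.
have [/existsP[v /andP[uv vw]]|/existsPn now] := boolP [exists v, edge u v && edge v w].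
  by left; exists v.
by right=> v; rewrite inE => uv; rewrite edge_sym; have := now v; rewrite uv.
Qed.

Lemma total_walks2_bipartite (G : sgraph) (A : {set G}) (u : G) :
  (forall x y : G, edge x y -> (x \in A) != (y \in A)) -> u \in A ->
  total_walks2 u = edges_between (@edge G) (neighborhood u) A.
Proof.
move=> bip uA; rewrite total_walks2E; apply: eq_bigr => v.
rewrite inE => /bip; rewrite uA => vA.
rewrite [RHS]big_mkcond (eq_bigl xpredT) => [|w]; last by rewrite inE.
apply: eq_bigr => w _; case: ifPn => // wA.
by case: (boolP (edge v w)) => // /bip; move: vA wA; do 2!case: (_ \in A).
Qed.

(** With h and h' the two halves of a + b, h h' - a b = (h - a)(h' - a), and for a <= b both factors
    are nonnegative. *)
Lemma leq_mul_half_uphalf (a b : nat) :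
  (a * b <= (a + b)./2 * uphalf (a + b))%N.
Proof.
wlog le_ab : a b / (a <= b)%N => [hwlog|].
  by have [/hwlog//|/ltnW/hwlog] := leqP a b; rewrite mulnC addnC.
have ha : (a <= (a + b)./2)%N by lia.
have ua : (a <= uphalf (a + b))%N by lia.
have : ((a + b)./2 + uphalf (a + b) = a + b)%N by lia.
by rewrite -(subnKC ha) -(subnKC ua); nia.
Qed.

(** The walks number at most |N(u)| times the size of the side of [u]. Positivity of [m] excludes an
    edgeless graph with an empty part, where equality would hold trivially. *)
Lemma bipartite_total_walks2 (G : sgraph) (A : {set G}) (u : G) m :
  (forall x y : G, edge x y -> (x \in A) != (y \in A)) ->
  (#|A| * #|~: A| <= m)%N -> (1 < #|G| -> 0 < m)%N ->
  (total_walks2 u <= m)%N /\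
  (total_walks2 u = m -> forall w, w != u ->
     edge u w \/ exists2 v, edge u v & edge v w).
Proof.
wlog uA : A / u \in A => [hwlog bip lem m_gt0|bip lem m_gt0].
  have [uA|uA] := boolP (u \in A); first exact: hwlog uA bip lem m_gt0.
  apply: (hwlog (~: A)); rewrite ?inE // ?setCK 1?mulnC // => x y /bip.
  by rewrite !inE; do 2!case: (_ \in A).
have twE := total_walks2_bipartite bip uA.
have sN : neighborhood u \subset ~: A.
  by apply/subsetP => v; rewrite !inE => /bip; rewrite uA.
have A_gt0 : (0 < #|A|)%N by apply/card_gt0P; exists u.
have leN := subset_leq_card sN.
have tw_le := edges_between_le (@edge G) (neighborhood u) A.
split; first by rewrite twE; nia.
move=> tw w wu; have [uw|uw] := boolP (edge u w); first by left.
right; have [//|now] := common_neighborP u w; exfalso.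
have {}m_gt0 : (0 < m)%N.
  apply: m_gt0; rewrite -cardsT (cardsD1 u) inE; apply/card_gt0P.
  by exists w; rewrite !inE wu.
(* A vertex [w] beyond distance two shrinks one factor of the bound by one: [A] if [w] lies in it,
   otherwise the room left for N(u). *)
have [wA|wA] := boolP (w \in A).
  have : edges_between (@edge G) (neighborhood u) A =
         edges_between (@edge G) (neighborhood u) (A :\ w).
    rewrite (edges_betweenC (@edge_sym G)) (edges_betweenD1 _ _ wA).
    rewrite no_edge_between ?add0n //.
    exact: edges_betweenC (@edge_sym G) _ _.
  have := edges_between_le (@edge G) (neighborhood u) (A :\ w).
  have : #|A| = #|A :\ w|.+1 by rewrite (cardsD1 w) wA.
  have : (0 < #|A :\ w|)%N by apply/card_gt0P; exists u; rewrite !inE eq_sym wu.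
  by nia.
have : (#|neighborhood u| <= #|~: A :\ w|)%N.
  apply/subset_leq_card/subsetP => v vN; rewrite in_setD1 (subsetP sN) // andbT.
  by apply: contraNneq uw => <-; rewrite inE in vN.
have : #|~: A| = #|~: A :\ w|.+1 by rewrite (cardsD1 w) inE wA.
by nia.
Qed.

(** * Walks of length two without an even cycle *)

Section EvenCycleFree.
Variables (G : sgraph) (k : nat) (u : G).
Hypothesis bip : bipartite G.
Hypothesis free : subgraph_free (cycle_graph k.*2.+2) G.

Let N := neighborhood u.
Let B := ~: (u |: N).

Let disjoint_NB : [disjoint N & B].
Proof.
rewrite -setI_eq0; apply/eqP/setP => v; rewrite !inE.
by case: (edge u v); rewrite ?orbT ?andbF.
Qed.

(** Both ends of such a path are adjacent to [u], which is off the path: its 2k+1 vertices and [u]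
    form a cycle. *)
Lemma neighborhood_alternating_path_free : alternating_path_free (@edge G) k N B.
Proof.
move=> x s xN lN p us sub; apply/eqP => szs; apply: free.
rewrite -szs; apply: (@contains_cycle G u (x :: s)).
  rewrite /cycle rcons_path /= p [edge _ u]edge_sym.
  by move: xN lN; rewrite !inE => -> ->.
have notu v : v \in N :|: B -> v != u.
  by apply: contraTneq => ->; rewrite !inE edge_irrefl eqxx.
rewrite cons_uniq us andbT inE negb_or eq_sym notu /=; last by rewrite in_setU xN.
by apply/negP => /sub/notu; rewrite eqxx.
Qed.

(** Each neighbour gives one walk back to [u]; no walk ends in [N], as a bipartite graph has no
    triangle. *)
Lemma total_walks2_neighborhood :
  total_walks2 u = (#|N| + edges_between (@edge G) N B)%N.
Proof.
rewrite total_walks2E /edges_between -sum1_card -big_split /=; apply: eq_bigr => v.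
rewrite inE => uv; have [A bipA] := bip.
rewrite (bigD1 u) ?inE //= edge_sym uv; congr (_ + _)%N.
rewrite big_mkcond [RHS]big_mkcond; apply: eq_bigr => w _; rewrite !inE /=.
case: eqP => //= _; case: ifPn => // /negPn uw.
case: (boolP (edge v w)) => // /bipA; move: uv uw => /bipA + /bipA.
by do 3!case: (_ \in A).
Qed.

Lemma card_neighborhood_complement : (#|N| + #|B| = #|G|.-1)%N.
Proof.
by rewrite -(cardsC (u |: N)) cardsU1 inE edge_irrefl.
Qed.

(** With k = j+1, adding |N| to e(N,B) <= j|N| + (j+1)|B| - j(j+1) gives k(|N| + |B| - j) =
    k(n-k). *)
Lemma even_cycle_free_total_walks2 : (0 < k)%N -> (k.*2.+1 < #|G|)%N ->
  (total_walks2 u <= k * (#|G| - k))%N /\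
  (total_walks2 u = (k * (#|G| - k))%N -> forall w, w != u ->
     edge u w \/ exists2 v, edge u v & edge v w).
Proof.
have := neighborhood_alternating_path_free.
have := card_neighborhood_complement; have := total_walks2_neighborhood.
case: k => // j twE cardE apf _ ltG.
have NBsize : (j.*2.+1 <= #|N| + #|B|)%N by rewrite cardE; lia.
have NB := edges_between_alternating_path_free (@edge_sym G) disjoint_NB apf NBsize.
split; first by nia.
move=> tw w wu; have [uw|uw] := boolP (edge u w); first by left.
right; have [//|now] := common_neighborP u w; exfalso.
(* Applying the edge bound without [w] lowers its right side by [j.+1] but not the edge count,
   against equality. *)
have wB : w \in B by rewrite !inE (negPf wu).
have BE : #|B| = #|B :\ w|.+1 by rewrite (cardsD1 w) wB.
have dNB : [disjoint N & B :\ w] by apply: disjointWr disjoint_NB; apply: subsetDl.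
have := edges_between_alternating_path_free (@edge_sym G) dNB
  (alternating_path_freeS (subxx _) (subsetDl _ _) apf).
have -> : edges_between (@edge G) N (B :\ w) = edges_between (@edge G) N B.
  rewrite [RHS](edges_betweenC (@edge_sym G)) (edges_betweenD1 _ _ wB).
  rewrite no_edge_between ?add0n //.
  exact: edges_betweenC (@edge_sym G) _ _.
nia.
Qed.

End EvenCycleFree.

Theorem theorem2p1 (R : realType) (t n : nat) (G : sgraph)
    (ht : (3 <= t)%N) (hn : #|G| = n)
    (hbip : bipartite G) (hfree : subgraph_free (cycle_graph t) G) :
  (odd t \/ (n < t)%N ->
     spectral_radius R G <= Num.sqrt (n./2 * uphalf n)%:R /\
     (spectral_radius R G = Num.sqrt (n./2 * uphalf n)%:R <->
      isomorphic G (complete_bipartite n./2 (uphalf n)))) /\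
  (forall k : nat, (1 <= k)%N -> t = (2 * k + 2)%N -> (t <= n)%N ->
     spectral_radius R G <= Num.sqrt (k * (n - k))%:R /\
     (spectral_radius R G = Num.sqrt (k * (n - k))%:R <->
      isomorphic G (complete_bipartite k (n - k)))).
Proof.
have [A bip] := hbip; split.
  move=> _; have abG : (n./2 + uphalf n)%N = #|G| by rewrite hn; lia.
  have bal : (#|A| * #|~: A| <= n./2 * uphalf n)%N.
    by rewrite -hn -(cardsC A); apply: leq_mul_half_uphalf.
  have m_gt0 : (1 < #|G| -> 0 < n./2 * uphalf n)%N by rewrite hn; nia.
  by apply: (spectral_radius_extremal R bip abG) => u;
    have [] := bipartite_total_walks2 u bip bal m_gt0.
move=> k k1 tk tn.
have tE : t = k.*2.+2 by lia.
rewrite tE in hfree tn; rewrite -hn in tn *.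
apply: (spectral_radius_extremal R bip) => [|u|u]; first by lia.
  by have [] := even_cycle_free_total_walks2 u hbip hfree k1 tn.
by have [] := even_cycle_free_total_walks2 u hbip hfree k1 tn.
Qed.
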